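(* Let $K$ be a finite simplicial complex, let $k\ge0$, and let $W_{k-1},W_k,W_{k+1}$ be positive definite diagonal matrices indexed by the $(k-1)$-, $k$- and $(k+1)$-simplices of $K$ respectively. Then the weighted Hodge Laplacian $$\Delta_k^W=\delta_{k+1}^{W}d_k+d_{k-1}\delta_k^{W}:C^k(K)\to C^k(K),\qquad \delta_{j+1}^{W}=W_j^{-1}d_j^{T}W_{j+1},$$ is self-adjoint and positive semidefinite with respect to the weighted inner product $\langle\alpha,\beta\rangle_{k,W}=\alpha^{T}W_k\beta$; that is, $\langle\Delta_k^W\alpha,\beta\rangle_{k,W}=\langle\alpha,\Delta_k^W\beta\rangle_{k,W}$ and $\langle\Delta_k^W\alpha,\alpha\rangle_{k,W}\ge0$ for all $\alpha,\beta\in C^k(K)$.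
   Context: $K_k$ denotes the set of (oriented) $k$-simplices of $K$, and $C^k(K)$ the real vector space of simplicial $k$-cochains, identified with column vectors in $\mathbb{R}^{K_k}$. Weight matrices have the form $W_k=\mathrm{diag}\{w_k(\sigma):\sigma\in K_k\}$ with all $w_k(\sigma)>0$. The map $d_k:C^k(K)\to C^{k+1}(K)$ is the simplicial coboundary operator, written as a matrix in the standard bases. In coordinates, $$\Delta_k^W=W_k^{-1}d_k^{T}W_{k+1}d_k+d_{k-1}W_{k-1}^{-1}d_{k-1}^{T}W_k.$$ Convention: $C^{-1}(K)=0$, so for $k=0$ the second term is zero; likewise the first term is zero if $K$ has no $(k+1)$-simplices. *)

(* Defs.v *)
From mathcomp Require Import all_boot all_order all_algebra.
From mathcomp Require Import reals.
Set Implicit Arguments.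
Unset Strict Implicit.
Unset Printing Implicit Defensive.
Import Order.TTheory GRing.Theory Num.Theory.
Local Open Scope ring_scope.

Record simplicial_complex (V : finType) := SimplicialComplex {
  faces :> {set {set V}};
  faces_neq0 : set0 \notin faces;
  faces_closed : forall s t : {set V},
    s \in faces -> t \subset s -> t != set0 -> t \in faces }.

(* Each simplex is oriented by a chosen ordering of its vertices; the orderings
   of different simplices need not be compatible, so that every choice of
   orientations is covered. *)
Record orientation (V : finType) (K : simplicial_complex V) := Orientation {
  vertices :> {set V} -> seq V;
  verticesP : forall s, s \in K -> perm_eq (vertices s) (enum s) }.

(* All families below are indexed by the number n of vertices of the simplices,
   not by their dimension n - 1: [cells K k.+1] is K_k, and [cells K k] is
   K_(k-1). *)
Definition cells (V : finType) (K : simplicial_complex V) (n : nat) :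
  {set {set V}} := [set s in K | #|s| == n].

(* The convention C^(-1)(K) = 0. *)
Lemma cells0 (V : finType) (K : simplicial_complex V) : cells K 0 = set0.
Proof.
apply/setP=> s; rewrite !inE cards_eq0; apply/andP=> -[sK /eqP s0].
by move: (faces_neq0 K); rewrite -s0 sK.
Qed.

Fixpoint inversions (s : seq nat) : nat :=
  if s is x :: s' then (count (fun y => y < x)%N s' + inversions s')%N else 0%N.

(* For duplicate-free sequences, the sign of the permutation relating the
   orderings s and t, and 0 if they do not have the same vertices. *)
Definition rel_sign (R : pzRingType) (V : eqType) (s t : seq V) : R :=
  if perm_eq s t then (-1) ^+ inversions [seq index x s | x <- t] else 0.

(* The incidence number of the oriented simplices [v_0, ..., v_m] and s, i.e.
   the coefficient of f(s) in
     (d f)([v_0, ..., v_m])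
       = \sum_i (-1)^i f([v_0, ..., v_(i-1), v_(i+1), ..., v_m]),
   where cochains f are alternating in the ordering of the vertices. *)
Definition incidence (R : pzRingType) (V : eqType) (t s : seq V) : R :=
  \sum_(i < size t) (-1) ^+ i * rel_sign R s (take i t ++ drop i.+1 t).

(* C^(n-1)(K), in the basis dual to the oriented (n-1)-simplices. *)
Definition cochain (R : realType) (V : finType) (K : simplicial_complex V)
  (n : nat) := 'cV[R]_#|cells K n|.

(* The matrix of d_(n-1) : C^(n-1)(K) -> C^n(K). *)
Definition coboundary (R : realType) (V : finType) (K : simplicial_complex V)
    (o : orientation K) (n : nat) : 'M[R]_(#|cells K n.+1|, #|cells K n|) :=
  \matrix_(i, j) incidence R (o (enum_val i)) (o (enum_val j)).

Definition posdef (R : realType) (n : nat) (W : 'M[R]_n) : Prop :=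
  W^T = W /\ forall x : 'cV[R]_n, x != 0 -> 0 < (x^T *m W *m x) 0 0.

(* A weight matrix W_(n-1), indexed by the (n-1)-simplices. *)
Definition weight_matrix (R : realType) (V : finType)
    (K : simplicial_complex V) (n : nat) (W : 'M[R]_#|cells K n|) : Prop :=
  is_diag_mx W /\ posdef W.

(* delta_n^W = W_(n-1)^-1 d_(n-1)^T W_n : C^n(K) -> C^(n-1)(K). *)
Definition codifferential (R : realType) (V : finType)
    (K : simplicial_complex V) (o : orientation K) (n : nat)
    (W : 'M[R]_#|cells K n|) (W' : 'M[R]_#|cells K n.+1|) :
    'M[R]_(#|cells K n|, #|cells K n.+1|) :=
  invmx W *m (coboundary R o n)^T *m W'.

(* Delta_k^W for the weights Wm = W_(k-1), W = W_k and Wp = W_(k+1). *)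
Definition hodge_laplacian (R : realType) (V : finType)
    (K : simplicial_complex V) (o : orientation K) (k : nat)
    (Wm : 'M[R]_#|cells K k|) (W : 'M[R]_#|cells K k.+1|)
    (Wp : 'M[R]_#|cells K k.+2|) : 'M[R]_#|cells K k.+1| :=
  codifferential o W Wp *m coboundary R o k.+1
  + coboundary R o k *m codifferential o Wm W.

Definition weighted_inner (R : realType) (n : nat) (W : 'M[R]_n)
  (a b : 'cV[R]_n) : R := (a^T *m W *m b) 0 0.

(* Main.v *)
(* Multiplying on the left by W turns Delta into
     d_k^T W_(k+1) d_k + (W d_(k-1)) W_(k-1)^-1 (W d_(k-1))^T,
   a sum of two congruence transforms of positive definite matrices. *)

Require Import Defs.
From mathcomp Require Import all_boot all_order all_algebra.
From mathcomp Require Import reals.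
Import Order.TTheory GRing.Theory Num.Theory.
Local Open Scope ring_scope.

(** The form [weighted_inner W (L *m a) b] of the Laplacian [L] has matrix [W *m L] once this matrix
    is known to be symmetric. By [mul_weight_hodge_laplacian] it is a sum of terms [A^T *m P *m A]
    with [P] positive definite ([Wp] or [invmx Wm]), hence symmetric and positive semidefinite. *)

Lemma posdef_unitmx {R : realType} {n : nat} {W : 'M[R]_n} :
  posdef W -> W \in unitmx.
Proof.
move=> [_ W_gt0]; rewrite unitmxE unitfE; apply/negP => /det0P[v v0 vW0].
(* A nonzero row vector [v] with [v *m W = 0] would make the quadratic form vanish at [v^T]. *)
have /W_gt0 : v^T != 0 by rewrite trmx_eq0.
by rewrite trmxK vW0 mul0mx mxE ltxx.
Qed.

Lemma posdef_ge0 {R : realType} {n : nat} {W : 'M[R]_n} (x : 'cV[R]_n) :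
  posdef W -> 0 <= weighted_inner W x x.
Proof.
rewrite /weighted_inner => -[_ W_gt0].
by have [->|/W_gt0/ltW//] := eqVneq x 0; rewrite mulmx0 mxE.
Qed.

(** With [y = invmx W *m x], the form of [invmx W] at [x] is that of [W] at [y]. *)
Lemma posdef_invmx {R : realType} {n : nat} {W : 'M[R]_n} :
  posdef W -> posdef (invmx W).
Proof.
move=> Wpos; have [WT W_gt0] := Wpos; have Wu := posdef_unitmx Wpos.
have VT : (invmx W)^T = invmx W by rewrite trmx_inv WT.
split=> // x x0.
have /W_gt0 : invmx W *m x != 0.
  by apply: contra_neq x0 => /(congr1 (mulmx W)); rewrite mulKVmx // mulmx0.
by rewrite trmx_mul VT -!mulmxA mulKVmx.
Qed.

Lemma weighted_inner_tr {R : realType} {n m : nat} (W : 'M[R]_n)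
    (A : 'M[R]_(n, m)) (x : 'cV[R]_m) :
  weighted_inner (A^T *m W *m A) x x = weighted_inner W (A *m x) (A *m x).
Proof. by rewrite /weighted_inner trmx_mul !mulmxA. Qed.

Lemma mul_weight_hodge_laplacian {R : realType} {V : finType}
    {K : simplicial_complex V} (o : orientation K) {k : nat}
    (Wm : 'M[R]_#|cells K k|) {W : 'M[R]_#|cells K k.+1|}
    (Wp : 'M[R]_#|cells K k.+2|) :
  posdef W ->
  W *m hodge_laplacian o Wm W Wp =
    (coboundary R o k.+1)^T *m Wp *m coboundary R o k.+1
    + ((coboundary R o k)^T *m W)^T *m invmx Wm *m ((coboundary R o k)^T *m W).
Proof.
move=> Wpos; have [WT _] := Wpos.
rewrite /hodge_laplacian /codifferential mulmxDr trmx_mul trmxK WT -!mulmxA.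
by rewrite mulKVmx ?posdef_unitmx.
Qed.

Theorem proposition4p4 (R : realType) (V : finType) (K : simplicial_complex V)
    (o : orientation K) (k : nat)
    (Wm : 'M[R]_#|cells K k|) (W : 'M[R]_#|cells K k.+1|)
    (Wp : 'M[R]_#|cells K k.+2|)
    (hWm : weight_matrix Wm) (hW : weight_matrix W) (hWp : weight_matrix Wp) :
  (forall a b : cochain R K k.+1,
     weighted_inner W (hodge_laplacian o Wm W Wp *m a) b
     = weighted_inner W a (hodge_laplacian o Wm W Wp *m b))
  /\ (forall a : cochain R K k.+1,
        0 <= weighted_inner W (hodge_laplacian o Wm W Wp *m a) a).
Proof.
have [[_ Wmpos] [_ Wpos] [_ Wppos]] := And3 hWm hW hWp.
have [[VmT _] [WT _] [WpT _]] := And3 (posdef_invmx Wmpos) Wpos Wppos.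
set L := hodge_laplacian o Wm W Wp.
have WL : W *m L = _ := mul_weight_hodge_laplacian o Wm Wp Wpos.
(* As [W] is symmetric, the left side is the transpose of [W *m L], whose two summands are
   symmetric. *)
have WLT : L^T *m W = W *m L.
  rewrite -{1}WT -trmx_mul WL linearD /= !(trmx_mul, trmxK) VmT WT WpT.
  by rewrite !mulmxA.
have innerL a b : weighted_inner W (L *m a) b = weighted_inner (W *m L) a b.
  by rewrite /weighted_inner trmx_mul -WLT !mulmxA.
split=> [a b|a]; rewrite innerL; first by rewrite /weighted_inner !mulmxA.
rewrite WL /weighted_inner mulmxDr mulmxDl mxE.
(* The summands are the squared norms of [d_k a] for [Wp] and of [d_(k-1)^T W a] for [invmx Wm]. *)
apply: addr_ge0; rewrite -/(weighted_inner _ _ _) weighted_inner_tr.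
  exact: posdef_ge0.
exact/posdef_ge0/posdef_invmx.
Qed.
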